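(* Let $t,\lambda$ be positive integers and $\ell$ a nonnegative integer with $t>\ell$. Then there exists $M$ such that the following holds for all $m\ge M$. Let $A$ be an $m$-rowed $(0,1)$-matrix such that no column whose column sum lies in $\{0,1,\dots,t\}\cup\{m-\ell+1,m-\ell+2,\dots,m\}$ is repeated (columns with other column sums may be repeated), and assume $(\lambda+2)\cdot{\bf 1}_t{\bf 0}_\ell\not\prec A$. Then $$\|A\|\le \sum_{i=0}^{t-1}\binom{m}{i}+\left(1+\frac{\lambda}{t+1}\right)\binom{m}{t}+\sum_{i=m-\ell+1}^{m}\binom{m}{i}.$$ Moreover, in the case of equality, the columns of column sum $t+1$ of $A$ form the incidence matrix of a $t$-$(m,t+1,\lambda)$ design, and all columns of sum $1,2,\dots,t$ and $m-\ell+1,m-\ell+2,\dots,m$ are present in $A$.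
   Context: $\|A\|$ is the number of columns of $A$ counted with multiplicity. ${\bf 1}_t{\bf 0}_\ell$ is the $(t+\ell)\times1$ column with $t$ ones on top of $\ell$ zeros, and $q\cdot{\bf v}$ is the matrix of $q$ copies of the column ${\bf v}$. For $(0,1)$-matrices $F,A$, $F\prec A$ means some submatrix of $A$ is a row and column permutation of $F$; thus $(\lambda+2)\cdot{\bf 1}_t{\bf 0}_\ell\prec A$ iff there are $t$ rows, $\ell$ further rows and $\lambda+2$ columns of $A$ such that these columns have $1$'s in all of the $t$ rows and $0$'s in all of the $\ell$ rows. A column is identified with the set of rows in which it has a $1$; a $t$-$(m,k,\lambda)$ design is a multiset of $k$-subsets of $[m]$ such that every $t$-subset of $[m]$ lies in exactly $\lambda$ of them, counted with multiplicity. *)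

(* Defs.v *)
From HB Require Import structures.
From mathcomp Require Import all_boot all_order all_algebra.

Set Implicit Arguments.
Unset Strict Implicit.
Unset Printing Implicit Defensive.

Import Order.TTheory GRing.Theory Num.Theory.

(* A (0,1)-matrix is a boolean matrix, [true] standing for 1.  The number of
   columns of [A : 'M[bool]_(m, n)], counted with multiplicity, is [n]. *)

Definition ones_zeros (t l : nat) : 'cV[bool]_(t + l) :=
  \col_(i < t + l) (i < t).

Definition copies (p q : nat) (v : 'cV[bool]_p) : 'M[bool]_(p, q) :=
  \matrix_(i < p, j < q) v i ord0.

(* The injections [f] and [g] are not required to be monotone: they select the
   rows and columns of the submatrix and also permute them. *)
Definition configuration (p q m n : nat)
    (F : 'M[bool]_(p, q)) (A : 'M[bool]_(m, n)) : Prop :=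
  exists (f : 'I_p -> 'I_m) (g : 'I_q -> 'I_n),
    [/\ injective f, injective g & mxsub f g A = F].

Definition colsum (m : nat) (v : 'cV[bool]_m) : nat := \sum_(i < m) v i ord0.

Definition colset (m : nat) (v : 'cV[bool]_m) : {set 'I_m} :=
  [set i | v i ord0].

(* The list [B] represents the multiset of blocks. *)
Definition design (t m k lambda : nat) (B : seq {set 'I_m}) : Prop :=
  (forall b : {set 'I_m}, b \in B -> #|b| = k) /\
  (forall T : {set 'I_m}, #|T| = t ->
     count (fun b : {set 'I_m} => T \subset b) B = lambda).

Definition blocks_of_sum (m n : nat) (A : 'M[bool]_(m, n)) (k : nat) :
    seq {set 'I_m} :=
  [seq colset (col j A) | j <- enum 'I_n & colsum (col j A) == k].

Definition forb_bound (t l lambda m : nat) : rat :=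
  (\sum_(0 <= i < t) 'C(m, i)%:R
   + (1 + lambda%:R / t.+1%:R) * 'C(m, t)%:R
   + \sum_((m - l).+1 <= i < m.+1) 'C(m, i)%:R)%R.

(* Main.v *)
(** Call a column small if its sum lies between [t] and [s = (m - l) / (lambda
    + 2)], and big if it lies between [s + 1] and [m - l]. Any [lambda + 2]
    small columns have [l] common zero rows, so every [t]-set of rows lies in at
    most [lambda + 1] small columns. Counting incidences between [t]-sets and
    small columns gives the bound on the number of small columns, where a column
    of sum [k >= t + 2] and an undercovered [t]-set cost a positive multiple of
    ['C(k, t)] and of [1].

    If a big column [c] exists, fix [l] rows [L] outside of [c]. A [t]-set
    [T] inside [c] that lies in [lambda + 1] small columns must lie in one that
    meets [L]: either its sum is at least [t + 2], or it is [T] plus a point of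
    [L], which happens for only [O(m^(t-1))] sets [T]. So the cost is of order
    [m^t], whereas there are only [O(m^l)] big columns and [l < t]. *)

Require Import Defs.
From HB Require Import structures.
From mathcomp Require Import all_boot all_order all_algebra.
From mathcomp Require Import zify ring.

Set Implicit Arguments.
Unset Strict Implicit.
Unset Printing Implicit Defensive.

Import Order.TTheory GRing.Theory Num.Theory.

(** * Counting subsets and estimating binomial coefficients *)

Lemma exists_subset_card (V : finType) (A : {set V}) k :
  k <= #|A| -> exists2 B : {set V}, B \subset A & #|B| = k.
Proof.
rewrite -bin_gt0 -cards_draws => /card_gt0P[B].
by rewrite inE => /andP[sBA /eqP cB]; exists B.
Qed.

Lemma leq_card_bigcup (I V : finType) (P : pred I) (F : I -> {set V}) :
  #|\bigcup_(i | P i) F i| <= \sum_(i | P i) #|F i|.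
Proof.
elim/big_rec2: _ => [|i n B _ leBn]; first by rewrite cards0.
by apply: leq_trans (leq_card_setU _ _) _; rewrite leq_add2l.
Qed.

Lemma leq_sum_const (I : finType) (P : pred I) (F : I -> nat) c :
  (forall i, P i -> F i <= c) -> \sum_(i | P i) F i <= #|P| * c.
Proof. by move=> leFc; rewrite -sum_nat_const; apply: leq_sum. Qed.

Lemma sum_card_draws (V : finType) (D : pred nat) :
  #|[set S : {set V} | D #|S|]| = \sum_(i < #|V|.+1 | D i) 'C(#|V|, i).
Proof.
pose cardS (S : {set V}) : 'I_#|V|.+1 := inord #|S|.
rewrite -sum1_card (partition_big cardS (fun i : 'I_#|V|.+1 => D i)) /=.
  apply: eq_bigr => i Di; rewrite sum1dep_card -card_draws.
  apply: eq_card => S; rewrite !inE /cardS -val_eqE /= inordK ?ltnS ?max_card //.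
  by case: eqP => [->|]; rewrite ?andbT ?andbF.
by move=> S; rewrite inE /cardS inordK // ltnS max_card.
Qed.

Lemma bin_leq_expn n k : 'C(n, k) <= n ^ k.
Proof.
rewrite (@leq_trans (n ^_ k)) //; first by rewrite -bin_ffact leq_pmulr ?fact_gt0.
elim: k n => [|k IHk] [|n] //; rewrite ffactSS expnS leq_mul2l /=.
by apply: leq_trans (IHk n) _; case: (k) => // j; rewrite leq_exp2r.
Qed.

(** Each factor of the falling factorial [n ^_ k] is at least [n - k]. *)
Lemma expn_leq_bin n k : (n - k) ^ k <= k`! * 'C(n, k).
Proof.
rewrite mulnC bin_ffact.
elim: k n => [|k IHk] [|n] //; first by rewrite exp0n.
rewrite ffactSS expnS subSS; apply: leq_mul; last exact: IHk.
by rewrite (leq_trans (leq_subr _ _)).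
Qed.

(** The worst case is [n = k.+2], where twice the coefficient is [k.+1 * k.+2], and [k.+2 >= 3]. *)
Lemma leq_mul3S_bin n k : 0 < k -> k.+2 <= n -> 3 * k.+1 <= 2 * 'C(n, k).
Proof.
move=> k0 lekn; apply: (@leq_trans (2 * 'C(k.+2, k))); last first.
  by rewrite leq_mul2l /= leq_bin2l.
rewrite -(bin_sub (leq_trans (leqnSn _) (leqnSn _))) subSn // subSnn.
by rewrite mul_bin_left bin1; nia.
Qed.

(** * Families of blocks, indexed by [J] so that repetitions count *)

Section Families.
Variables (V J : finType) (X : J -> {set V}) (t l lam s : nat).

Hypothesis X_avoids : forall T L : {set V},
  #|T| = t -> #|L| = l -> [disjoint T & L] ->
  #|[set j | (T \subset X j) && [disjoint L & X j]]| <= lam.+1.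

Definition small_blocks := [set j | t <= #|X j| <= s].
Definition big_blocks := [set j | s < #|X j| <= #|V| - l].
Definition coverage (T : {set V}) := #|[set j in small_blocks | T \subset X j]|.

Lemma sum_coverage :
  \sum_(T : {set V} | #|T| == t) coverage T
  = \sum_(j in small_blocks) 'C(#|X j|, t).
Proof.
transitivity (\sum_(T : {set V} | #|T| == t)
                \sum_(j in small_blocks) (T \subset X j : nat)).
  apply: eq_bigr => T _; rewrite /coverage -sum1_card big_mkcond /=.
  rewrite [RHS]big_mkcond; apply: eq_bigr => j _; rewrite in_set.
  by case: (j \in _); case: (_ \subset _).
rewrite exchange_big /=; apply: eq_bigr => j _.
rewrite -cards_draws -sum1_card [RHS]big_mkcond [LHS]big_mkcond /=.
by apply: eq_bigr => T _; rewrite inE andbC; case: (_ == _); case: (_ \subset _).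
Qed.

Lemma big_block_misses c : c \in big_blocks ->
  exists2 L : {set V}, L \subset ~: X c & #|L| = l.
Proof.
rewrite inE => /andP[sc cl]; apply: exists_subset_card.
by have := cardsC (X c); have := max_card (mem (X c)); lia.
Qed.

(** Double counting of triples formed by a big block, an [l]-set outside it and a [t]-set inside it.
    Below, one [l]-set per block suffices. Above, a disjoint pair of sets lies in at most [lam.+1]
    triples by [X_avoids], and a pair that meets lies in none. *)
Lemma card_big_blocks :
  #|big_blocks| * 'C(s, t) <= 'C(#|V|, l) * ('C(#|V|, t) * lam.+1).
Proof.
pose hit (L T : {set V}) j := (T \subset X j) && [disjoint L & X j].
have -> : 'C(#|V|, l) * ('C(#|V|, t) * lam.+1)
    = \sum_(L : {set V} | #|L| == l) \sum_(T : {set V} | #|T| == t) lam.+1.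
  by rewrite !sum_nat_const -!card_draws !cardsE.
apply: (@leq_trans (\sum_(j in big_blocks) \sum_(L : {set V} | #|L| == l)
    \sum_(T : {set V} | #|T| == t) hit L T j)).
  rewrite -sum_nat_const; apply: leq_sum => c big_c.
  have [L sL cL] := big_block_misses big_c.
  move: big_c; rewrite inE => /andP[sc _].
  rewrite (bigD1 L) /=; last exact/eqP.
  apply: leq_trans (leq_addr _ _); apply: leq_trans (leq_bin2l t (ltnW sc)) _.
  rewrite -cards_draws -sum1_card big_mkcond [X in _ <= X]big_mkcond /=.
  apply: leq_sum => T _; rewrite inE andbC /hit disjoints_subset sL andbT.
  by case: (_ == _); case: (_ \subset _).
rewrite exchange_big /=; apply: leq_sum => L /eqP cL.
rewrite exchange_big /=; apply: leq_sum => T /eqP cT.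
have [TL|TL] := boolP [disjoint T & L].
  apply: leq_trans (X_avoids cT cL TL); rewrite -sum1_card.
  rewrite big_mkcond [X in _ <= X]big_mkcond /=; apply: leq_sum => j _.
  by rewrite [j \in [set _ | _]]inE -/(hit L T j); case: (hit _ _ _); case: ifP.
rewrite big1 // => j _; apply/eqP; rewrite eqb0; apply: contra TL.
by case/andP => TX LX; rewrite disjoint_sym (disjointWr TX).
Qed.

Hypothesis s_small : lam.+2 * s + l <= #|V|.

(* [lam.+2] small blocks miss at least [l] common points. *)
Lemma coverage_le (T : {set V}) : #|T| = t -> coverage T <= lam.+1.
Proof.
move=> cT; rewrite leqNgt; apply/negP.
case/exists_subset_card=> G /subsetP sG cG.
pose U := \bigcup_(j in G) X j.
have cU : #|U| <= lam.+2 * s.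
  apply: leq_trans (leq_card_bigcup _ _) _.
  rewrite -cG; apply: leq_sum_const => j /sG.
  by rewrite !inE => /andP[/andP[_ ->]].
have [L sL cL] : exists2 L : {set V}, L \subset ~: U & #|L| = l.
  by apply: exists_subset_card; have := cardsC U; lia.
have TL : [disjoint T & L].
  have [|j Gj] := card_gt0P (_ : 0 < #|G|); first by rewrite cG.
  have := sG j Gj; rewrite !inE => /andP[_ TX].
  rewrite disjoint_sym; apply: disjointWr (subset_trans TX (bigcup_sup _ Gj)) _.
  by rewrite -/U disjoints_subset.
have := X_avoids cT cL TL; rewrite leqNgt => /negP; apply.
rewrite -cG; apply: subset_leq_card; apply/subsetP => j Gj.
have := sG j Gj; rewrite !inE => /andP[_ ->] /=.
by rewrite disjoints_subset (subset_trans sL) // setCS (bigcup_sup j).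
Qed.

Definition wide_blocks := [set j in small_blocks | t.+2 <= #|X j|].
Definition wide_weight := \sum_(j in wide_blocks) 'C(#|X j|, t).
Definition deficiency := \sum_(T : {set V} | #|T| == t) (lam.+1 - coverage T).

Hypothesis t_gt0 : 0 < t.

(* A wide block of weight [w] wastes [w - t.+1 >= w / 3]. *)
Lemma small_blocks_weight :
  3 * t.+1 * #|small_blocks| + wide_weight
  <= 3 * \sum_(j in small_blocks) 'C(#|X j|, t)
     + 3 * t * #|[set j in small_blocks | #|X j| == t]|.
Proof.
rewrite /wide_weight -!sum1_card !big_distrr /=.
under [X in _ + X <= _]eq_bigl => j do rewrite inE.
under [X in _ <= _ + X]eq_bigl => j do rewrite inE.
rewrite [X in _ + X <= _]big_mkcondr [X in _ <= _ + X]big_mkcondr /=.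
rewrite -!big_split /=; apply: leq_sum => j; rewrite inE => /andP[tj _].
case: (ltngtP #|X j| t.+1) => [lej|gtj|->].
- have ->: #|X j| = t by lia.
  by rewrite eqxx binn /=; lia.
- by have := leq_mul3S_bin t_gt0 gtj; case: ifP; lia.
- by rewrite binSn; case: eqP => /=; lia.
Qed.

Lemma deficiency_coverage :
  deficiency + \sum_(T : {set V} | #|T| == t) coverage T
  = lam.+1 * 'C(#|V|, t).
Proof.
rewrite -big_split /= -card_draws mulnC -sum_nat_const.
rewrite [RHS](eq_bigl (fun T : {set V} => #|T| == t)); last by move=> T; rewrite inE.
by apply: eq_bigr => T /eqP cT; rewrite subnK ?coverage_le.
Qed.

(** By double counting, the total weight is [lam.+1 * 'C(#|V|, t)] minus the deficiency. A block of
    size [t] has weight 1 instead of [t.+1], hence the allowance of [t] for each; the factor 3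
    avoids fractions. *)
Lemma small_blocks_bound :
  3 * t.+1 * #|small_blocks| + wide_weight + 3 * deficiency
  <= 3 * lam.+1 * 'C(#|V|, t)
     + 3 * t * #|[set j in small_blocks | #|X j| == t]|.
Proof.
have := small_blocks_weight; have := deficiency_coverage.
by rewrite sum_coverage -mulnA; lia.
Qed.

Lemma big_block_loss (c : J) : c \in big_blocks ->
  'C(s, t) <= deficiency + wide_weight + l * lam.+1 * 'C(#|V|, t.-1).
Proof.
move=> big_c; have [L sL cL] := big_block_misses big_c.
move: big_c; rewrite inE => /andP[sc _].
pose D := [set T : {set V} | (#|T| == t) && (coverage T <= lam)].
pose W := \bigcup_(j in wide_blocks) [set T : {set V} | T \subset X j & #|T| == t].
(* [E] collects the [T] for which [x |: T] is a small block with [x] in [L]. Writing [S] for [T]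
   minus a point, [x |: S] is a [t]-set, so [coverage_le] leaves at most [lam.+1] blocks for each
   [S] and [x]. *)
pose E := \bigcup_(S : {set V} | #|S| == t.-1) \bigcup_(x in L | x \notin S)
   \bigcup_(j in small_blocks | x |: S \subset X j) [set X j :\ x].
have cD : #|D| <= deficiency.
  rewrite /deficiency -sum1_card big_mkcond [X in _ <= X]big_mkcond /=.
  by apply: leq_sum => T _; rewrite inE; case: eqP => //= _; case: ifP => //; lia.
have cW : #|W| <= wide_weight.
  apply: leq_trans (leq_card_bigcup _ _) _; apply: leq_sum => j _.
  by rewrite cards_draws.
have cE : #|E| <= l * lam.+1 * 'C(#|V|, t.-1).
  apply: leq_trans (leq_card_bigcup _ _) _.
  rewrite -card_draws cardsE mulnC; apply: leq_sum_const => S /eqP cS.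
  apply: leq_trans (leq_card_bigcup _ _) _.
  apply: (@leq_trans (\sum_(x in L) lam.+1)); last by rewrite sum_nat_const cL.
  rewrite big_mkcondr; apply: leq_sum => x _; case: ifP => // xS.
  apply: leq_trans (leq_card_bigcup _ _) _.
  under eq_bigr do rewrite cards1.
  rewrite sum1dep_card; apply: leq_trans (coverage_le (T := x |: S) _); last first.
    by rewrite cardsU1 xS cS; lia.
  exact: leqnn.
have sub : [set T : {set V} | T \subset X c & #|T| == t] \subset D :|: W :|: E.
  apply/subsetP => T; rewrite inE => /andP[TX cT].
  rewrite !in_setU [T \in D]inE cT /=.
  case: leqP => //= full.
  have TL : [disjoint T & L].
    rewrite disjoint_sym disjoints_subset (subset_trans sL) // setCS //.
  have [j sj /andP[Tj mj]] : exists2 j, j \in small_blocks &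
      (T \subset X j) && ~~ [disjoint L & X j].
    (* If every small block through [T] missed [L], these blocks together with [c], which is not
       small, would be [lam.+2] blocks violating [X_avoids]. *)
    apply/exists_inP; apply: contraTT (X_avoids (eqP cT) cL TL).
    rewrite negb_exists_in => /forall_inP H; rewrite -ltnNge.
    apply: leq_ltn_trans full _.
    apply: proper_card; apply/properP; split.
      apply/subsetP => j; rewrite !in_set => /andP[sj Tj].
      by have := H j; rewrite in_set sj Tj negbK => /(_ isT).
    exists c; first by rewrite inE TX disjoints_subset.
    by rewrite !inE TX andbT negb_and -!ltnNge sc orbT.
  case: (leqP t.+2 #|X j|) => [wj|nj].
    apply/orP; left; apply/bigcupP; exists j; first by rewrite inE sj.
    by rewrite inE Tj.
  apply/orP; right.
  have [x Lx Xx] : exists2 x, x \in L & x \in X j.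
    by move: mj; rewrite -setI_eq0 => /set0Pn[x /setIP[]]; exists x.
  have xT : x \notin T by apply: contraL (Lx) => xT; rewrite (disjointFr TL).
  have [y Ty] : exists y, y \in T by apply/card_gt0P; rewrite (eqP cT).
  apply/bigcupP; exists (T :\ y).
    by have := cardsD1 y T; rewrite Ty (eqP cT); lia.
  apply/bigcupP; exists x; first by rewrite Lx !inE negb_and xT orbT.
  apply/bigcupP; exists j.
    by rewrite sj subUset sub1set Xx (subset_trans (subsetDl _ _)).
  (* [X j] has at most [t.+1] points, so removing [x] leaves no room beyond [T]. *)
  rewrite inE; apply/eqP/eqP; rewrite eqEcard; apply/andP; split.
    apply/subsetP => z Tz; rewrite !inE (subsetP Tj) // andbT.
    by apply: contraNneq xT => <-.
  by have := cardsD1 x (X j); rewrite Xx (eqP cT); lia.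
apply: leq_trans (leq_bin2l t (ltnW sc)) _; rewrite -cards_draws.
apply: leq_trans (subset_leq_card sub) _; apply: leq_trans (leq_card_setU _ _) _.
by apply: leq_add cE; apply: leq_trans (leq_card_setU _ _) _; apply: leq_add.
Qed.

(** Size [t] is left out because blocks of that size are counted among the small ones. *)
Definition extreme_sets := [set S : {set V} | (#|S| < t) || (#|V| - l < #|S|)].
Definition extreme_blocks := [set j | X j \in extreme_sets].

Hypothesis X_inj : forall j j',
  (#|X j| <= t) || (#|V| - l < #|X j|) -> X j = X j' -> j = j'.

Lemma card_extreme_blocks : #|extreme_blocks| = #|X @: extreme_blocks|.
Proof.
rewrite card_in_imset // => j j'; rewrite !inE => Ej _; apply: X_inj.
by case/orP: Ej => [/ltnW|] ->; rewrite ?orbT.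
Qed.

Lemma sub_extreme_blocks : X @: extreme_blocks \subset extreme_sets.
Proof. by apply/subsetP => S /imsetP[j]; rewrite inE => ? ->. Qed.

Definition t_blocks := [set j in small_blocks | #|X j| == t].

Lemma card_t_blocks : #|t_blocks| = #|X @: t_blocks|.
Proof.
rewrite card_in_imset // => j j'; rewrite !inE => /andP[_ /eqP Ej] _.
by apply: X_inj; rewrite Ej leqnn.
Qed.

Lemma sub_t_blocks : X @: t_blocks \subset [set S : {set V} | #|S| == t].
Proof. by apply/subsetP => S /imsetP[j]; rewrite !inE => /andP[_ ?] ->. Qed.

Hypothesis t_lt_s : t < s.

Lemma card_blocks_split :
  #|J| = #|extreme_blocks| + #|small_blocks| + #|big_blocks|.
Proof.
rewrite -cardsT -!sum1_card !(big_mkcond (fun j => j \in _)) -!big_split /=.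
apply: eq_bigr => j _; rewrite !inE.
have s_le : s <= #|V| - l by nia.
by do 3!case: ifP; lia.
Qed.

(** The loss that one big block forces by [big_block_loss] exceeds the gain from all big blocks
    together. *)
Hypothesis few_big_blocks :
  3 * t.+1 * #|big_blocks| + l * lam.+1 * 'C(#|V|, t.-1) < 'C(s, t).

(** This is [t.+1] times the bound of the theorem, which keeps the counting in [nat]. *)
Definition family_bound := t.+1 * #|extreme_sets| + (t.+1 + lam) * 'C(#|V|, t).

Lemma family_bound_slack :
  [/\ t.+1 * #|J| <= family_bound &
      t.+1 * #|J| = family_bound ->
      [/\ #|extreme_blocks| = #|extreme_sets|, #|t_blocks| = 'C(#|V|, t),
          #|big_blocks| = 0, wide_weight = 0 & deficiency = 0]].
Proof.
have lee := subset_leq_card sub_extreme_blocks.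
have let_ := subset_leq_card sub_t_blocks.
rewrite -card_extreme_blocks in lee; rewrite -card_t_blocks card_draws in let_.
have bound := small_blocks_bound; rewrite -/t_blocks in bound.
have big0 : 0 < #|big_blocks| ->
    'C(s, t) <= deficiency + wide_weight + l * lam.+1 * 'C(#|V|, t.-1).
  by case/card_gt0P => c /big_block_loss.
rewrite card_blocks_split /family_bound.
move: few_big_blocks bound big0 lee let_ t_gt0.
move: #|extreme_blocks| #|extreme_sets| #|t_blocks| #|small_blocks| wide_weight deficiency.
move: 'C(#|V|, t) (l * lam.+1 * _) 'C(s, t) #|big_blocks| => C R S b e E a sm w d.
move=> few bound big0 lee lea t0.
have tt : t * a <= t * C by rewrite leq_mul2l lea orbT.
have te : t.+1 * e <= t.+1 * E by rewrite leq_mul2l lee orbT.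
(* A big block makes the bound strict, so the equality clause is vacuous. Without big blocks,
   equality forces every inequality used to be tight. *)
have [b0|b_gt0] := posnP b; last first.
  by have := big0 b_gt0; split; nia.
subst b; split; first nia.
move=> eq; have eqE : t.+1 * e = t.+1 * E by nia.
have eqC : t * a = t * C by nia.
by split; nia.
Qed.

Lemma family_bound_extreme (S : {set V}) : t.+1 * #|J| = family_bound ->
  (#|S| <= t) || (#|V| - l < #|S|) -> exists j, X j = S.
Proof.
move=> eqJ; have [_ /(_ eqJ)[eqe eqt _ _ _]] := family_bound_slack.
have eqE : X @: extreme_blocks = extreme_sets.
  by apply/eqP; rewrite eqEcard sub_extreme_blocks -card_extreme_blocks eqe /=.
have eqT : X @: t_blocks = [set S : {set V} | #|S| == t].
  by apply/eqP; rewrite eqEcard sub_t_blocks -card_t_blocks card_draws eqt /=.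
rewrite leq_eqVlt -orbA => /orP[St|SE].
  have : S \in X @: t_blocks by rewrite eqT inE.
  by case/imsetP => j _ ->; exists j.
have : S \in X @: extreme_blocks by rewrite eqE inE.
by case/imsetP => j _ ->; exists j.
Qed.

(** Zero deficiency puts [T] in exactly [lam.+1] small blocks. One of them is [T] itself, only once
    by [X_inj]; the others have size [t.+1], since zero [wide_weight] excludes larger ones. *)
Lemma family_bound_design (T : {set V}) : t.+1 * #|J| = family_bound ->
  #|T| = t -> #|[set j | (#|X j| == t.+1) && (T \subset X j)]| = lam.
Proof.
move=> eqJ cT; have [_ /(_ eqJ)[_ _ _ w0 d0]] := family_bound_slack.
have covT : coverage T = lam.+1.
  have /eqP := d0; rewrite sum_nat_eq0 => /forall_inP/(_ T).
  rewrite cT eqxx subn_eq0 => /(_ isT) ge.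
  by apply/eqP; rewrite eqn_leq ge coverage_le.
have [|j0 Xj0] := family_bound_extreme (S := T) eqJ; first by rewrite cT leqnn.
have -> : [set j | (#|X j| == t.+1) && (T \subset X j)]
          = [set j in small_blocks | T \subset X j] :\ j0.
  apply/setP => j; rewrite !inE.
  have [->|ne] := eqVneq j j0; first by rewrite Xj0 cT; case: eqP => //=; lia.
  have [Tj|] := boolP (T \subset X j); rewrite ?andbF // !andbT /=.
  apply/eqP/andP => [->|[tj js]]; first by split; lia.
  apply/eqP; case: ltngtP => //= [jt|jt].
    case/eqP: ne; apply/esym/X_inj; rewrite Xj0 ?cT ?leqnn //.
    by apply/eqP; rewrite eqEcard Tj cT -ltnS.
  have := w0; rewrite /wide_weight (bigD1 j) /=; last by rewrite !inE tj js.
  by move/eqP; rewrite addn_eq0 -leqn0 leqNgt bin_gt0 tj.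
have := cardsD1 j0 [set j in small_blocks | T \subset X j].
rewrite -/(coverage T) covT !inE Xj0 cT leqnn subxx (ltnW t_lt_s) /=.
by rewrite add1n => -[].
Qed.
End Families.

(** * Asymptotics: big blocks cost more than they gain *)

Lemma few_big_blocks_eventually t l lam : 0 < t -> l < t ->
  exists M, forall m b, M <= m -> let s := (m - l) %/ lam.+2 in
  [/\ t < s, lam.+2 * s + l <= m &
      b * 'C(s, t) <= 'C(m, l) * ('C(m, t) * lam.+1) ->
      3 * t.+1 * b + l * lam.+1 * 'C(m, t.-1) < 'C(s, t)].
Proof.
move=> t0 lt.
(* Here [b] stands for the number of big blocks. [Q] is chosen so that [m ^ t <= Q * 'C(s, t)], and
   [R * m ^ t.-1] bounds the left side of the goal. *)
pose Q := (2 * lam.+2) ^ t * t`!.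
pose R := 3 * t.+1 * (Q * lam.+1) + l * lam.+1.
(* The first summand ensures [t < s] and [m <= 2 * lam.+2 * (s - t)]; the second ensures
   [Q * R < m]. *)
exists (2 * (l + lam.+1 + lam.+2 * t) + (Q * R).+1) => m b Mm s.
have Hs : m - l < lam.+2 * s.+1 by rewrite mulnC ltn_ceil.
have Hs' : lam.+2 * s <= m - l by rewrite mulnC leq_trunc_div.
have ts : t < s by rewrite -(ltn_pmul2l (ltn0Sn lam.+1)); nia.
have mK : m <= 2 * lam.+2 * (s - t).
  by rewrite -mulnA mulnBr; rewrite mulnS in Hs; lia.
split=> //; first by lia.
move=> big.
have m0 : 0 < m by lia.
have mQ : m ^ t <= Q * 'C(s, t).
  apply: (@leq_trans ((2 * lam.+2 * (s - t)) ^ t)); first by rewrite leq_exp2r.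
  by rewrite expnMn /Q -mulnA leq_mul2l expn_leq_bin orbT.
have bb : b <= Q * lam.+1 * m ^ t.-1.
  apply: (@leq_trans (Q * lam.+1 * m ^ l)); last first.
    by rewrite leq_mul2l leq_pexp2l ?orbT //; lia.
  rewrite -(@leq_pmul2r (m ^ t)) ?expn_gt0 ?m0 //.
  apply: (@leq_trans (Q * (b * 'C(s, t)))).
    by rewrite mulnCA leq_mul2l mQ orbT.
  apply: (@leq_trans (Q * (m ^ l * (m ^ t * lam.+1)))); last by nia.
  rewrite leq_mul2l; apply/orP; right; apply: leq_trans big _.
  by rewrite leq_mul ?bin_leq_expn // leq_mul ?bin_leq_expn.
have cb := bin_leq_expn m t.-1.
have leR : 3 * t.+1 * b + l * lam.+1 * 'C(m, t.-1) <= R * m ^ t.-1.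
  rewrite /R mulnDl -(mulnA (3 * t.+1)).
  by apply: leq_add; rewrite leq_mul2l ?bb ?cb orbT.
apply: leq_ltn_trans leR _.
have Q0 : 0 < Q by rewrite /Q muln_gt0 expn_gt0 fact_gt0.
rewrite -(ltn_pmul2l Q0); apply: leq_trans mQ.
rewrite -(prednK t0) expnS /= mulnA ltn_pmul2r ?expn_gt0 ?m0 //; lia.
Qed.

(** * From matrices to families of sets *)

Lemma colsumE m (v : 'cV[bool]_m) : colsum v = #|colset v|.
Proof.
rewrite /colsum -sum1_card [RHS]big_mkcond; apply: eq_bigr => i _.
by rewrite inE; case: (v i ord0).
Qed.

Lemma colset_inj m : injective (@colset m).
Proof.
move=> u v /setP eq; apply/colP => i; have := eq i.
by rewrite !inE.
Qed.

(** The hypothesis keeps the two ranges of extreme sums disjoint, so the sum over all sizes can be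
    cut at [t] and [(m - l).+1]. *)
Lemma forb_boundE t l lam m : t + l <= m ->
  (t.+1%:R * forb_bound t l lam m)%R
  = (family_bound 'I_m t l lam)%:R%R.
Proof.
move=> tlm; rewrite /family_bound /extreme_sets card_ord.
rewrite (sum_card_draws 'I_m (fun i => (i < t) || (m - l < i))) card_ord.
rewrite -(big_mkord (fun i => (i < t) || (m - l < i)) (fun i => 'C(m, i))).
rewrite (@big_cat_nat _ _ _ t) //=; last by lia.
rewrite (@big_cat_nat _ _ _ (m - l).+1 t) //=; [|lia|lia].
have -> : \sum_(0 <= i < t | (i < t) || (m - l < i)) 'C(m, i)
          = \sum_(0 <= i < t) 'C(m, i).
  by rewrite big_nat_cond [RHS]big_nat_cond; apply: eq_bigl => i; lia.
have -> : \sum_(t <= i < (m - l).+1 | (i < t) || (m - l < i)) 'C(m, i) = 0.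
  by rewrite big_nat_cond big1 // => i; lia.
have -> : \sum_((m - l).+1 <= i < m.+1 | (i < t) || (m - l < i)) 'C(m, i)
          = \sum_((m - l).+1 <= i < m.+1) 'C(m, i).
  by rewrite big_nat_cond [RHS]big_nat_cond; apply: eq_bigl => i; lia.
rewrite add0n /forb_bound -!natr_sum.
rewrite natrD !natrM !natrD.
have : (t.+1%:R : rat)%R != 0%R by rewrite pnatr_eq0.
by move: (t.+1%:R)%R => x x0; field.
Qed.

Lemma avoids_of_not_configuration m n (A : 'M[bool]_(m, n)) t l lam :
  0 < t ->
  ~ configuration (copies (lam + 2) (ones_zeros t l)) A ->
  forall T L : {set 'I_m}, #|T| = t -> #|L| = l -> [disjoint T & L] ->
  #|[set j | (T \subset colset (col j A)) && [disjoint L & colset (col j A)]]|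
    <= lam.+1.
Proof.
move=> t0 noconf T L cT cL TL; rewrite leqNgt; apply/negP => many.
set G := [set j | _] in many; apply: noconf.
(* [i0] and [j0] only serve as default values for [nth]. *)
have /card_gt0P[i0 _] : 0 < #|T| by rewrite cT.
have /card_gt0P[j0 _] : 0 < #|G| by apply: leq_trans many.
(* Listing [T] before [L] matches the ones above the zeros in [ones_zeros]. *)
pose r := enum T ++ enum L.
have sr : size r = t + l by rewrite size_cat -!cardE cT cL.
have ur : uniq r.
  rewrite cat_uniq !enum_uniq andbT /=; apply/hasPn => x; rewrite !mem_enum => Lx.
  by rewrite (disjointFl TL).
have ltG (j : 'I_(lam + 2)) : j < size (enum G).
  by rewrite -cardE; have := ltn_ord j; lia.
exists (fun i => nth i0 r i), (fun j => nth j0 (enum G) j); split.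
- move=> i i' /eqP; rewrite nth_uniq ?sr ?ltn_ord // => /eqP; exact: val_inj.
- move=> j j' /eqP; rewrite nth_uniq ?enum_uniq // => /eqP; exact: val_inj.
apply/matrixP => i j; rewrite !mxE.
have : nth j0 (enum G) j \in G.
  by rewrite -mem_enum mem_nth.
rewrite inE => /andP[/subsetP TX LX].
rewrite nth_cat -cardE cT; case: ltnP => it.
  have /TX : nth i0 (enum T) i \in T by rewrite -mem_enum mem_nth // -cardE cT.
  by rewrite inE mxE.
have : nth i0 (enum L) (i - t) \in L.
  by rewrite -mem_enum mem_nth // -cardE cL; have := ltn_ord i; lia.
by move/(disjointFr LX); rewrite inE mxE.
Qed.

Theorem theorem4 (t lambda l : nat) (ht : 0 < t) (hlambda : 0 < lambda)
    (hl : l < t) :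
  exists M : nat, forall m : nat, M <= m ->
  forall (n : nat) (A : 'M[bool]_(m, n)),
    (forall j j' : 'I_n,
       (colsum (col j A) <= t) || ((m - l).+1 <= colsum (col j A) <= m) ->
       col j A = col j' A -> j = j') ->
    ~ configuration (copies (lambda + 2) (ones_zeros t l)) A ->
    (n%:R <= forb_bound t l lambda m)%R /\
    (n%:R%R = forb_bound t l lambda m ->
       design t t.+1 lambda (blocks_of_sum A t.+1) /\
       (forall v : 'cV[bool]_m,
          (1 <= colsum v <= t) || ((m - l).+1 <= colsum v <= m) ->
          exists j : 'I_n, col j A = v)).
Proof.
have [M HM] := few_big_blocks_eventually lambda ht hl.
exists M => m Mm n A A_inj noconf.
pose X j := colset (col j A).
have avoids := avoids_of_not_configuration ht noconf.
set s := (m - l) %/ lambda.+2.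
have [t_s s_m few] := HM m #|big_blocks X l s| Mm; rewrite -/s in t_s s_m few.
have card_le (B : {set 'I_m}) : #|B| <= m by rewrite -[m in _ <= m]card_ord max_card.
have X_inj j j' : (#|X j| <= t) || (#|'I_m| - l < #|X j|) -> X j = X j' -> j = j'.
  rewrite card_ord => Xj /colset_inj; apply: A_inj.
  by rewrite colsumE card_le andbT.
have s_V : lambda.+2 * s + l <= #|'I_m| by rewrite card_ord.
have {}few : 3 * t.+1 * #|big_blocks X l s| + l * lambda.+1 * 'C(#|'I_m|, t.-1) < 'C(s, t).
  rewrite card_ord; apply: few.
  by have := card_big_blocks (X := X) s avoids; rewrite card_ord.
have [ub _] := family_bound_slack (X := X) avoids s_V ht X_inj t_s few.
rewrite card_ord in ub.
have t1 : (0 < t.+1%:R :> rat)%R by rewrite ltr0Sn.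
have tlm : t + l <= m by nia.
(* Both the bound and the equality case pass from [rat] to [nat] by multiplying by [t.+1]. *)
split; first by rewrite -(ler_pM2l t1) forb_boundE // -natrM ler_nat.
move/(congr1 (fun x => t.+1%:R * x)%R); rewrite forb_boundE // -natrM.
move/eqP; rewrite eqr_nat -{1}(card_ord n) => /eqP eqJ.
split.
  split=> [b|T cT].
    by case/mapP => j; rewrite mem_filter colsumE => /andP[/eqP cj _] ->.
  rewrite -(family_bound_design (X := X) avoids s_V ht X_inj t_s few eqJ cT).
  rewrite count_map count_filter cardE size_filter enumT.
  by apply: eq_count => j /=; rewrite inE colsumE andbC.
move=> v; rewrite colsumE => hv.
have [|j Xj] := family_bound_extreme (X := X) avoids s_V ht X_inj t_s few (S := colset v) eqJ.
  by rewrite card_ord; case/orP: hv => /andP[h1 h2]; rewrite ?h1 ?h2 ?orbT.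
by exists j; apply: colset_inj.
Qed.
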